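(* Let $N\in\mathbb{N}$, let $X$ be a complex Banach space, and let $E=\ell^p(\mathbb{Z}^N,X)$ with $p\in[1,\infty)$ or $E=c_0(\mathbb{Z}^N,X)$. Let $\Omega\subset\mathbb{R}^N$ be a valid starlike set, with associated projections $P_n$ and $Q_n=I-P_n$ on $E$ ($n\in\mathbb{N}$). Let $A:E\to E$ be a bounded and invertible linear operator such that, for every $n\in\mathbb{N}$, $\|Q_mAP_n\|\to 0$ as $m\to\infty$. Let $b\in E$ and let $u_0=A^{-1}b$ be the exact solution of $Au=b$. Then for every $\varepsilon>0$ there are parameters $\delta>0$ and $m,n\in\mathbb{N}$ such that every solution $u\in\operatorname{im}P_n$ of $$\|P_mAP_nu-P_mb\|<\delta \qquad\text{(rFSM)}$$ satisfies $\|u-u_0\|<\varepsilon$. Precisely, there are three functions $\delta_0:\mathbb{R}_+\to\mathbb{R}_+$, $n_0:\mathbb{R}_+\to\mathbb{N}$ and $m_0:\mathbb{R}_+^2\times\mathbb{N}\to\mathbb{N}$ such that, for all $\varepsilon>0$, $\delta>0$ and $m,n\in\mathbb{N}$: if $\delta<\delta_0(\varepsilon)$, $n\ge n_0(\delta)$ and $m\ge m_0(\varepsilon,\delta,n)$, then every solution $u\in\operatorname{im}P_n$ of (rFSM) with parameters $\delta,m,n$ satisfies $\|u-u_0\|<\varepsilon$.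
   Context: $\ell^p(\mathbb{Z}^N,X)$ is the Banach space of functions $u:\mathbb{Z}^N\to X$ with finite norm $\|u\|=\big(\sum_{k\in\mathbb{Z}^N}\|u(k)\|_X^p\big)^{1/p}$ for $p\in[1,\infty)$, and $\|u\|=\sup_k\|u(k)\|_X$ for $p=\infty$. A set $\Omega\subset\mathbb{R}^N$ is a valid starlike set if it is bounded, nonempty, and for every $x\in\Omega$ and $\alpha\in[0,1)$ the point $\alpha x$ is an interior point of $\Omega$. For $n\in\mathbb{N}=\{1,2,\dots\}$ put $\Omega_n:=n\Omega\cap\mathbb{Z}^N$; $P_n:E\to E$ is the operator of multiplication by the characteristic function of $\Omega_n$, and $Q_n:=I-P_n$. $c_0(\mathbb{Z}^N,X)=\{u\in\ell^\infty(\mathbb{Z}^N,X): P_nu\to u \text{ as } n\to\infty\}$, with the supremum norm. $\operatorname{im}P_n$ denotes the range of $P_n$. $\mathbb{R}_+$ denotes the positive real numbers. The functions $\delta_0,n_0,m_0$ may depend on $A$ and $b$ (which are fixed). Operator norms are those induced by the norm of $E$. *)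

(* Defs.v *)
From HB Require Import structures.
From mathcomp Require Import all_boot all_order all_algebra.
From mathcomp Require Import all_classical all_reals all_analysis.
From mathcomp Require Import complex ring.

Set Implicit Arguments.
Unset Strict Implicit.
Unset Printing Implicit Defensive.

Import Order.TTheory GRing.Theory Num.Theory.
Import numFieldNormedType.Exports.

Local Open Scope classical_set_scope.
Local Open Scope ring_scope.
Local Open Scope complex_scope.

Section starlike.
Context {R : realType} {N : nat}.
Implicit Types Omega : set 'rV[R]_N.

Definition valid_starlike Omega :=
  [/\ bounded_set Omega, Omega !=set0 &
      forall x (alpha : R), Omega x -> 0 <= alpha < 1 ->
        interior Omega (alpha *: x)].

(* The trace on Z^N of the dilation n Omega. *)
Definition lattice_section Omega (n : nat) : set 'rV[int]_N :=
  [set k | exists2 x, Omega x & map_mx intr k = n%:R *: x].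

End starlike.

Section lpnorm.
Context {R : realType} {T : choiceType} {X : normedModType R[i]}.
Implicit Types (u v : T -> X) (p : \bar R).

(* Norms in a normed space over R[i] are elements of R[i]; this is the same
   norm as an element of R. *)
Definition rnorm {Y : normedModType R[i]} (x : Y) : R := complex.Re `|x|.

(* The exponents of interest satisfy 1 <= p; the value at -oo is junk. *)
Definition lpnorm p u : \bar R :=
  match p with
  | r%:E => (poweR (\esum_(k in setT) (rnorm (u k) `^ r)%:E) r^-1)%E
  | +oo%E => ereal_sup (range (fun k => (rnorm (u k))%:E))
  | -oo%E => 0%E
  end.

Definition lp p : set (T -> X) := [set u | (lpnorm p u < +oo)%E].

End lpnorm.

Section lpnorm_theory.
Context {R : realType} {N : nat} {X : normedModType R[i]}.
Local Notation Z := 'rV[int]_N.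
Implicit Types (u v : Z -> X) (p : \bar R).

Lemma rnormE (x : X) : `|x| = (rnorm x)%:C.
Proof.
have := normr_ge0 x; rewrite lecE /= => /andP[/eqP i0 _].
by apply/eqP; rewrite eq_complex /= i0 !eqxx.
Qed.

Lemma rnorm_ge0 (x : X) : 0 <= rnorm x.
Proof. by rewrite -ler0c -rnormE. Qed.

Lemma rnormD (x y : X) : rnorm (x + y) <= rnorm x + rnorm y.
Proof. by rewrite -lecR rmorphD /= -!rnormE ler_normD. Qed.

Lemma rnorm0 : rnorm (0 : X) = 0.
Proof. by rewrite /rnorm normr0. Qed.

Lemma rnorm_eq0 (x : X) : rnorm x = 0 -> x = 0.
Proof. by move=> x0; apply/eqP; rewrite -normr_eq0 rnormE x0. Qed.

Lemma rnormZ (c : R[i]) (x : X) : rnorm (c *: x) = complex.Re `|c| * rnorm x.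
Proof.
rewrite /rnorm normrZ rnormE; case: (`|c|) => a b /=.
by rewrite mulr0 subr0.
Qed.

Lemma Re_norm_ge0 (c : R[i]) : 0 <= complex.Re `|c|.
Proof. by have := normr_ge0 c; rewrite lecE => /andP[]. Qed.

Lemma esumZl (c : R) (T : choiceType) (a : T -> R) : 0 <= c -> (forall k, 0 <= a k) ->
  (\esum_(k in setT) (c * a k)%:E = c%:E * \esum_(k in setT) (a k)%:E)%E.
Proof.
move=> c0 a0; rewrite /esum -ereal_supZl //.
  congr ereal_sup; apply/seteqP; split => x /=.
    move=> [F FT <-]; exists (\sum_(k \in F) (a k)%:E)%E; first by exists F.
    rewrite ge0_mule_fsumr// => k; by rewrite lee_fin.
  move=> [_ [F FT <-] <-]; exists F => //.
  rewrite ge0_mule_fsumr// => k; by rewrite lee_fin.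
by apply/set0P; exists 0%E; exists set0; [exact: fsets_set0|rewrite fsbig_set0].
Qed.


Lemma rnorm_le_lpnormy u k : ((rnorm (u k))%:E <= lpnorm +oo u)%E.
Proof. by apply: ereal_sup_ubound; exists k. Qed.

Lemma lpnormy_le u (M : \bar R) :
  (forall k, (rnorm (u k))%:E <= M)%E -> (lpnorm +oo u <= M)%E.
Proof. by move=> uM; apply: ge_ereal_sup => _ [k _ <-]. Qed.

Lemma lpsum_ge0 r u : (0 <= \esum_(k in setT) (rnorm (u k) `^ r)%:E)%E.
Proof. by apply: esum_ge0 => k _; rewrite lee_fin powR_ge0. Qed.

Lemma rnorm_powR_le_lpsum r u k :
  ((rnorm (u k) `^ r)%:E <= \esum_(k in setT) (rnorm (u k) `^ r)%:E)%E.
Proof.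
apply: esum_ge; exists [set k]; first by split => //; exact: finite_set1.
by rewrite fsbig_set1.
Qed.

Lemma poweR_le (r : R) (x y : \bar R) : 0 <= r -> (0 <= x)%E -> (x <= y)%E ->
  (poweR x r <= poweR y r)%E.
Proof.
move=> r0 x0 xy; apply: gt0_ler_poweR => //; rewrite in_itv /= leey andbT //.
exact: le_trans xy.
Qed.

Lemma le_lpnorm p u v : (1 <= p)%E ->
  (forall k, rnorm (u k) <= rnorm (v k)) -> (lpnorm p u <= lpnorm p v)%E.
Proof.
case: p => [r| |] //; rewrite ?lee_fin => r1 uv; last first.
  apply: lpnormy_le => k; apply: le_trans (rnorm_le_lpnormy v k).
  by rewrite lee_fin.
have r0 : 0 <= r by apply: le_trans r1.
apply: poweR_le; rewrite ?invr_ge0// ?lpsum_ge0//.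
by apply: le_esum => k _; rewrite lee_fin ge0_ler_powR// nnegrE rnorm_ge0.
Qed.

Lemma lpnorm0 p : (1 <= p)%E -> lpnorm p (0 : Z -> X) = 0%E.
Proof.
case: p => [r| |] //; rewrite ?lee_fin => r1; last first.
  rewrite -[RHS]ereal_sup1; congr ereal_sup.
  apply/seteqP; split => x /=; first by move=> [k _ <-]; rewrite rnorm0.
  by move=> ->; exists 0 => //; rewrite rnorm0.
have r0 : r != 0 by rewrite gt_eqF// (lt_le_trans _ r1).
rewrite /lpnorm esum1 ?poweR0r ?invr_eq0// => k _.
by rewrite rnorm0 powR0.
Qed.

Lemma lpnorm_ge0 p u : (1 <= p)%E -> (0 <= lpnorm p u)%E.
Proof.
move=> p1; rewrite -(lpnorm0 p1); apply: le_lpnorm => // k.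
by rewrite rnorm0 rnorm_ge0.
Qed.

Lemma lpnorm_eq0 p u : (1 <= p)%E -> lpnorm p u = 0%E -> u = 0.
Proof.
case: p => [r| |] //; rewrite ?lee_fin => r1 u0; apply/funext => k;
  apply: rnorm_eq0; apply/eqP; rewrite eq_le rnorm_ge0 andbT; last first.
  by rewrite -lee_fin -[leRHS]u0 rnorm_le_lpnormy.
have /eqP := poweR_eq0_eq0 (lpsum_ge0 r u) u0.
rewrite eq_le => /andP[S0 _].
have := le_trans (rnorm_powR_le_lpsum r u k) S0.
rewrite lee_fin => n0.
have /eqP : rnorm (u k) `^ r = 0 by apply/eqP; rewrite eq_le n0 powR_ge0.
by rewrite powR_eq0 => /andP[/eqP -> _].
Qed.

Lemma lpnormZ p (c : R[i]) u : (1 <= p)%E ->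
  lpnorm p (c *: u) = ((complex.Re `|c|)%:E * lpnorm p u)%E.
Proof.
have c0 := Re_norm_ge0 c.
case: p => [r| |] //; rewrite ?lee_fin => r1; last first.
  rewrite /lpnorm -ereal_supZl//; last by apply/set0P; exists (rnorm (u 0))%:E, 0.
  congr ereal_sup; apply/seteqP; split => x /=.
    move=> [k _ <-]; exists (rnorm (u k))%:E; first by exists k.
    by rewrite -EFinM -rnormZ.
  by move=> [_ [k _ <-] <-]; exists k => //; rewrite -EFinM -rnormZ.
have r0 : r != 0 by rewrite gt_eqF// (lt_le_trans _ r1).
rewrite /lpnorm.
under eq_esum do rewrite rnormZ powRM ?rnorm_ge0//.
rewrite esumZl ?powR_ge0// => [|k]; last exact: powR_ge0.
rewrite poweRM ?lpsum_ge0 ?lee_fin ?powR_ge0//.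
by rewrite poweR_EFin -powRrM mulfV// powRr1.
Qed.

(* The convexity inequality behind Minkowski's inequality. *)
Lemma powRD_le (r a b x y : R) : 1 <= r -> 0 < a -> 0 < b -> 0 <= x -> 0 <= y ->
  (x + y) `^ r <= (a + b) `^ r * (a / (a + b) / a `^ r * x `^ r +
                                  b / (a + b) / b `^ r * y `^ r).
Proof.
move=> r1 a0 b0 x0 y0.
have ab0 : 0 < a + b by rewrite addr_gt0.
have t01 : 0 <= a / (a + b) <= 1.
  by rewrite divr_ge0 ?(ltW a0) ?(ltW ab0)//= ler_pdivrMr// mul1r lerDl ltW.
have H : (a / (a + b) * (x / a) + (1 - a / (a + b)) * (y / b)) `^ r <=
    a / (a + b) * (x / a) `^ r + (1 - a / (a + b)) * (y / b) `^ r.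
  have := @convex_powR R r r1 (Itv01 (andP t01).1 (andP t01).2) (x / a) (y / b).
  rewrite !inE /= !in_itv /= !andbT !divr_ge0 ?(ltW a0) ?(ltW b0)//.
  exact: (fun h => h isT isT).
have e1 : 1 - a / (a + b) = b / (a + b).
  by rewrite -{1}(divff (lt0r_neq0 ab0)) -mulrBl addrAC subrr add0r.
have powdiv (z w : R) : 0 <= z -> 0 < w -> (z / w) `^ r = z `^ r / w `^ r.
  move=> z0 w0; rewrite powRM ?invr_ge0 ?(ltW w0)//; congr (_ * _).
  by rewrite -(powR_inv1 (ltW w0)) -powRrM mulrC powRrM powR_inv1 ?powR_ge0.
rewrite e1 in H.
have -> : x + y = (a + b) * (a / (a + b) * (x / a) + b / (a + b) * (y / b)).
  by field; rewrite !lt0r_neq0.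
rewrite powRM ?(ltW ab0)//; last first.
  by rewrite addr_ge0// !mulr_ge0 ?invr_ge0 ?(ltW a0) ?(ltW b0) ?(ltW ab0).
rewrite ler_pM2l ?powR_gt0//; apply: le_trans H _.
rewrite !powdiv// le_eqVlt; apply/orP; left; apply/eqP.
by congr (_ + _); rewrite -!mulrA; congr (_ * _); congr (_ * _); rewrite mulrC.
Qed.

Lemma lpsumE (r a : R) u : 1 <= r -> 0 <= a -> lpnorm r%:E u = a%:E ->
  (\esum_(k in setT) (rnorm (u k) `^ r)%:E = (a `^ r)%:E)%E.
Proof.
move=> r1 a0 ua; have r0 : r != 0 by rewrite gt_eqF// (lt_le_trans _ r1).
rewrite -(poweR_EFin a r) -ua /lpnorm -poweRrM mulVf// poweRe1//.
exact: lpsum_ge0.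
Qed.

Lemma ler_lpnormD p u v : (1 <= p)%E ->
  (lpnorm p (u + v)%R <= lpnorm p u + lpnorm p v)%E.
Proof.
move=> p1; have u0 := lpnorm_ge0 u p1; have v0 := lpnorm_ge0 v p1.
have [/(lpnorm_eq0 p1) uE|un0] := eqVneq (lpnorm p u) 0%E.
  by rewrite uE add0r leeDr// lpnorm_ge0.
have [/(lpnorm_eq0 p1) vE|vn0] := eqVneq (lpnorm p v) 0%E.
  by rewrite vE addr0 leeDl// lpnorm_ge0.
case: p p1 u0 v0 un0 vn0 => [r| |] //; rewrite ?lee_fin => r1 u0 v0 un0 vn0;
  last first.
  apply: lpnormy_le => k; apply: le_trans (leeD (rnorm_le_lpnormy _ k)
    (rnorm_le_lpnormy _ k)).
  by rewrite -EFinD lee_fin rnormD.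
case ua : (lpnorm r%:E u) u0 un0 => [a| |]// a0 an0; last first.
  by rewrite addye ?leey// gt_eqF// (lt_le_trans _ v0).
case vb : (lpnorm r%:E v) v0 vn0 => [b| |]// b0 bn0; last by rewrite leey.
have {an0}a_gt0 : 0 < a by rewrite lt_neqAle eq_sym an0 -lee_fin.
have {bn0}b_gt0 : 0 < b by rewrite lt_neqAle eq_sym bn0 -lee_fin.
have r0 : r != 0 by rewrite gt_eqF// (lt_le_trans _ r1).
have ab0 : 0 < a + b by rewrite addr_gt0.
have <- : (poweR ((a + b) `^ r)%:E r^-1 = a%:E + b%:E)%E.
  by rewrite poweR_EFin -powRrM mulfV// powRr1 ?ltW.
apply: poweR_le; rewrite ?invr_ge0 ?(le_trans _ r1)// ?lpsum_ge0//.
pose c1 := (a + b) `^ r * (a / (a + b) / a `^ r).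
pose c2 := (a + b) `^ r * (b / (a + b) / b `^ r).
have c10 : 0 <= c1 by rewrite !mulr_ge0 ?invr_ge0 ?powR_ge0 ?ltW.
have c20 : 0 <= c2 by rewrite !mulr_ge0 ?invr_ge0 ?powR_ge0 ?ltW.
apply: (@le_trans _ _ (\esum_(k in setT) ((c1 * rnorm (u k) `^ r)%:E +
                                         (c2 * rnorm (v k) `^ r)%:E))%E).
  apply: le_esum => k _; rewrite -EFinD lee_fin.
  apply: (@le_trans _ _ ((rnorm (u k) + rnorm (v k)) `^ r)).
    rewrite ge0_ler_powR ?(le_trans _ r1)// ?nnegrE ?addr_ge0 ?rnorm_ge0//.
    exact: rnormD.
  apply: le_trans (powRD_le r1 a_gt0 b_gt0 _ _) _; rewrite ?rnorm_ge0//.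
  by rewrite mulrDr /c1 /c2 -!mulrA.
rewrite esumD; try by move=> k _; rewrite lee_fin mulr_ge0 ?powR_ge0.
rewrite !esumZl; try by [|move=> k; exact: powR_ge0].
rewrite (lpsumE r1 (ltW a_gt0) ua) (lpsumE r1 (ltW b_gt0) vb) -!EFinM -EFinD lee_fin.
have e1 : a `^ r != 0 by rewrite gt_eqF// powR_gt0.
have e2 : b `^ r != 0 by rewrite gt_eqF// powR_gt0.
rewrite le_eqVlt; apply/orP; left; apply/eqP; rewrite /c1 /c2.
by field; rewrite e1 e2 gt_eqF.
Qed.

End lpnorm_theory.

Section seqspace_def.
Context {R : realType} {N : nat} (X : normedModType R[i]).
Local Notation Z := 'rV[int]_N.
Implicit Types (Omega : set 'rV[R]_N) (u : Z -> X).

Definition cutoff (D : set Z) u : Z -> X := fun k => if k \in D then u k else 0.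

Definition c0 Omega : set (Z -> X) :=
  [set u | lp +oo u /\
    lpnorm +oo (cutoff (lattice_section Omega n) u - u) @[n --> \oo] --> 0%E].

(* A finite exponent p stands for l^p(Z^N, X), and p = +oo stands for
   c_0(Z^N, X), not for l^infinity(Z^N, X). *)
Definition seqset Omega (p : \bar R) : set (Z -> X) :=
  if p == +oo%E then c0 Omega else lp p.

Definition seqpred Omega (p : \bar R) (p1 : (1 <= p)%E) : {pred Z -> X} :=
  mem (seqset Omega p).

Record seqspace Omega (p : \bar R) (p1 : (1 <= p)%E) := Seqspace {
  seqval :> Z -> X ;
  _ : seqval \in seqpred Omega p1 }.

End seqspace_def.

Arguments c0 {R N} X Omega.
Arguments seqset {R N} X Omega p.
Arguments seqpred {R N} X Omega {p} p1.
Arguments seqspace {R N} X Omega {p} p1.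

Section cutoff_theory.
Context {R : realType} {N : nat} {X : normedModType R[i]}.
Local Notation Z := 'rV[int]_N.
Implicit Types (Omega : set 'rV[R]_N) (u v : Z -> X) (p : \bar R) (D : set Z).

Lemma cutoff0 D : cutoff D (0 : Z -> X) = 0.
Proof. by apply/funext => k; rewrite /cutoff if_same. Qed.

Lemma cutoff_linear D (c : R[i]) u v :
  cutoff D (c *: u + v) = c *: cutoff D u + cutoff D v.
Proof.
apply/funext => k; rewrite /cutoff !fctE.
by case: ifP => // _; rewrite scaler0 addr0.
Qed.

Lemma cutoffC D D' u : cutoff D (cutoff D' u) = cutoff D' (cutoff D u).
Proof. by apply/funext => k; rewrite /cutoff; do 2 case: ifP. Qed.

Lemma le_lpnorm_cutoff p D u : (1 <= p)%E ->
  (lpnorm p (cutoff D u) <= lpnorm p u)%E.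
Proof.
move=> p1; apply: le_lpnorm => // k; rewrite /cutoff.
by case: ifP => // _; rewrite rnorm0 rnorm_ge0.
Qed.

Lemma lp_submod p (c : R[i]) u v : (1 <= p)%E -> lp p u -> lp p v ->
  lp p (c *: u + v).
Proof.
move=> p1 ulp vlp; apply: (le_lt_trans (ler_lpnormD _ _ p1)).
rewrite lpnormZ// lte_add_pinfty// lte_mul_pinfty// ?lee_fin ?Re_norm_ge0//.
Qed.

Lemma seqset_lp Omega p u : seqset X Omega p u -> lp p u.
Proof. by rewrite /seqset; case: eqP => [-> []|]. Qed.

Lemma cutoff_seqset Omega p D u : (1 <= p)%E ->
  seqset X Omega p u -> seqset X Omega p (cutoff D u).
Proof.
rewrite /seqset; case: eqP => [->|_] p1.
  move=> [ulp ucvg]; split; first exact: le_lt_trans (le_lpnorm_cutoff _ _ _) _.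
  apply: squeeze_cvge (cvg_cst _) ucvg.
  apply: nearW => n; rewrite lpnorm_ge0// andTb cutoffC.
  have -> : cutoff D (cutoff (lattice_section Omega n) u) - cutoff D u =
      cutoff D (cutoff (lattice_section Omega n) u - u).
    by apply/funext => k; rewrite /cutoff !fctE; case: ifP => //; rewrite subr0.
  exact: le_lpnorm_cutoff.
exact: le_lt_trans (le_lpnorm_cutoff _ _ p1).
Qed.

Lemma seqset_submod Omega p (c : R[i]) u v : (1 <= p)%E ->
  seqset X Omega p u -> seqset X Omega p v -> seqset X Omega p (c *: u + v).
Proof.
rewrite /seqset; case: eqP => [->|_] p1; last exact: lp_submod.
move=> [ulp uc] [vlp vc]; split; first exact: lp_submod.
pose c1 := (complex.Re `|c|)%:E.
have c10 : (0 <= c1)%E by rewrite lee_fin Re_norm_ge0.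
pose d (w : Z -> X) n := lpnorm +oo (cutoff (lattice_section Omega n) w - w).
have H : (fun n => (c1 * d u n + d v n)%E) @ \oo --> 0%E.
  have -> : 0%E = (c1 * 0 + 0)%E by rewrite mule0 adde0.
  by apply: cvgeD => //; first [exact: cvgeZl | rewrite mule0].
apply: squeeze_cvge (cvg_cst _) H.
apply: nearW => n; rewrite lpnorm_ge0// andTb cutoff_linear opprD addrACA -scalerBr.
by rewrite (le_trans (ler_lpnormD _ _ p1))// lpnormZ.
Qed.

Lemma seqset0 Omega p : (1 <= p)%E -> seqset X Omega p 0.
Proof.
move=> p1.
have lp0 : (lpnorm p (0%R : Z -> X) < +oo)%E by rewrite lpnorm0// ltry.
move: p1 lp0; rewrite /seqset; case: eqP => [->|_] p1 lp0 //; split => //.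
rewrite (_ : (fun n => _) = fun=> 0%E); first exact: cvg_cst.
by apply/funext => n; rewrite cutoff0 subrr lpnorm0.
Qed.

End cutoff_theory.

Section seqspace_normed.
Context {R : realType} {N : nat} {X : normedModType R[i]}.
Context {Omega : set 'rV[R]_N} {p : \bar R} {p1 : (1 <= p)%E}.
Local Notation E := (seqspace X Omega p1).
Implicit Types u v : E.

HB.instance Definition _ := [isSub for @seqval R N X Omega p p1].
HB.instance Definition _ := [Choice of E by <:].

Lemma seqpredP (f : 'rV[int]_N -> X) :
  f \in seqpred X Omega p1 <-> seqset X Omega p f.
Proof. by rewrite /seqpred !inE. Qed.

Lemma seqvalP u : seqset X Omega p u.
Proof. exact/seqpredP/(valP u). Qed.

Lemma seqpred_submod_closed : submod_closed (seqpred X Omega p1).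
Proof.
split; first exact/seqpredP/seqset0.
move=> c u v /seqpredP us /seqpredP vs.
exact/seqpredP/seqset_submod.
Qed.

HB.instance Definition _ := GRing.isSubmodClosed.Build R[i] ('rV[int]_N -> X)
  (seqpred X Omega p1) seqpred_submod_closed.
HB.instance Definition _ := [SubChoice_isSubLmodule of E by <:].

Definition seqnorm u : R[i] := (fine (lpnorm p u))%:C.

Lemma lpnorm_fin u : lpnorm p u \is a fin_num.
Proof.
by rewrite ge0_fin_numE ?lpnorm_ge0//; exact: seqset_lp (seqvalP u).
Qed.

Lemma ler_seqnormD u v : seqnorm (u + v) <= seqnorm u + seqnorm v.
Proof.
rewrite -rmorphD lecR -lee_fin EFinD !fineK ?lpnorm_fin//.
exact: ler_lpnormD.
Qed.

Lemma seqnormZ (c : R[i]) u : seqnorm (c *: u) = `|c| * seqnorm u.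
Proof.
rewrite /seqnorm (lpnormZ _ _ p1) fineM ?lpnorm_fin// rmorphM /=.
by congr (_ * _); rewrite -[RHS](@rnormE R R[i]^o).
Qed.

Lemma seqnorm_eq0 u : seqnorm u = 0 -> u = 0.
Proof.
move=> /complexI u0; apply/val_inj/(lpnorm_eq0 p1).
by rewrite -[LHS]fineK ?lpnorm_fin// u0.
Qed.

HB.instance Definition _ := @Lmodule_isNormed.Build R[i] E seqnorm
  ler_seqnormD seqnormZ seqnorm_eq0.

Fact truncation_subproof (n : nat) u :
  cutoff (lattice_section Omega n) u \in seqpred X Omega p1.
Proof. exact/seqpredP/cutoff_seqset/seqvalP. Qed.

Definition truncP (n : nat) u : E := Seqspace (truncation_subproof n u).

Definition truncQ (n : nat) u : E := u - truncP n u.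

Definition rFSM (A : E -> E) (b : E) (delta : R) (m n : nat) u :=
  range (truncP n) u /\ `|truncP m (A (truncP n u)) - truncP m b| < delta%:C.

End seqspace_normed.

(* Extended-real valued, so that an unbounded T has norm +oo. *)
Definition opnorm {R : realType} {V W : normedModType R[i]} (T : V -> W) :
    \bar R :=
  ereal_sup [set (rnorm (T v))%:E | v in [set v : V | rnorm v <= 1]].

(* Main.v *)
(** Once [|u| <= C |A u|] is known, which is Banach's bounded inverse theorem,
    a solution [u] of the truncated inequality satisfies
    [A u - b = (P_m A u - P_m b) + Q_m A P_n u - Q_m b].  If
    [|Q_m A P_n| <= 1 / (2 C)], absorbing the middle term gives the a priori
    bound [|u| <= 2 C (delta + |b|)]; each of the three terms is then at most
    [eps / (3 C)] as soon as [delta < eps / (3 C)] and [m] is large.  The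
    inverse theorem needs completeness of [E], inherited from [X] because the
    p-norm is lower semicontinuous under coordinatewise convergence. *)
Require Import Defs.
From HB Require Import structures.
From mathcomp Require Import all_boot all_order all_algebra.
From mathcomp Require Import all_classical all_reals all_analysis.
From mathcomp Require Import complex.
From mathcomp Require Import ring lra.

Set Implicit Arguments.
Unset Strict Implicit.
Unset Printing Implicit Defensive.

Import Order.TTheory GRing.Theory Num.Theory.
Import numFieldNormedType.Exports.

Local Open Scope classical_set_scope.
Local Open Scope ring_scope.
Local Open Scope complex_scope.

(** * The real-valued norm and nested balls *)

Section rnorm_theory.
Context {R : realType} {V : normedModType R[i]}.
Implicit Types x y : V.

Lemma rnormN x : rnorm (- x) = rnorm x.
Proof. by rewrite /rnorm normrN. Qed.

Lemma rdistC x y : rnorm (x - y) = rnorm (y - x).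
Proof. by rewrite -rnormN opprB. Qed.

Lemma ler_rdistD y x z : rnorm (x - z) <= rnorm (x - y) + rnorm (y - z).
Proof. by rewrite (le_trans _ (rnormD _ _))// addrA subrK. Qed.

Lemma rnormZr (c : R) x : 0 <= c -> rnorm (c%:C *: x) = c * rnorm x.
Proof.
move=> c0; apply: complexI.
by rewrite rmorphM /= -!rnormE normrZ ger0_norm ?ler0c.
Qed.

(** An epsilon positive in [R[i]] has zero imaginary part, so real epsilons suffice. *)
Lemma cvg_rnormP (T : Type) (F : set_system T) (FF : Filter F) (f : T -> V) l :
  f @ F --> l <->
  forall e : R, 0 < e -> \forall t \near F, rnorm (l - f t) <= e.
Proof.
split=> [/cvgrPdist_le fl e e0|fl].
  have := fl e%:C; rewrite ltcR => /(_ e0); apply: filterS => t.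
  by rewrite rnormE lecR.
apply/cvgrPdist_le => -[e i] /=; rewrite ltcE /= => /andP[/eqP -> e0].
by apply: filterS (fl _ e0) => t; rewrite rnormE lecR.
Qed.

Lemma cauchy_rnormP (F : set_system V) (FF : ProperFilter F) :
  cauchy F <->
  forall e : R, 0 < e -> exists x, \forall y \near F, rnorm (x - y) <= e.
Proof.
split=> [/cauchyP cF e e0|cF].
  have [|x Fx] := cF e%:C; first by rewrite ltcR.
  exists x; apply: filterS Fx => y.
  by rewrite -ball_normE /= rnormE ltcR => /ltW.
apply/cauchyP => -[e i]; rewrite ltcE /= => /andP[/eqP -> e0].
(* Halving leaves room for the strict inequality in the definition of balls. *)
have [x Fx] := cF (e / 2) (divr_gt0 e0 (ltr0Sn _ 1)).
exists x; apply: filterS Fx => y xy.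
rewrite -ball_normE /= rnormE ltcR (le_lt_trans xy)//.
by rewrite ltr_pdivrMr// ltr_pMr// ltr1n.
Qed.

End rnorm_theory.

(** The first hypothesis telescopes: [x (n + k)] lies within [r n - r (n + k)] of [x n], so the
    sequence is Cauchy and the bound [r n] survives the limit. This serves both the Baire argument
    and the summation of a geometric series. *)
Lemma nested_balls {R : realType} {V : completeNormedModType R[i]}
    (x : nat -> V) (r : nat -> R) :
  (forall n, rnorm (x n.+1 - x n) + r n.+1 <= r n) -> (forall n, 0 <= r n) ->
  r @ \oo --> (0 : R) ->
  exists l, (x @ \oo --> l) /\ forall n, rnorm (l - x n) <= r n.
Proof.
move=> xr r0 rcvg.
have xD n k : rnorm (x (n + k)%N - x n) + r (n + k)%N <= r n.
  elim: k => [|k ih]; first by rewrite addn0 subrr rnorm0 add0r.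
  rewrite addnS (le_trans _ ih)//.
  have := ler_rdistD (x (n + k)%N) (x (n + k).+1) (x n); have := xr (n + k)%N.
  lra.
have xnear n : \forall m \near \oo, rnorm (x n - x m) <= r n.
  near=> m; have nm : (n <= m)%N by near: m; exact: nbhs_infty_ge.
  by have := xD n (m - n)%N; rewrite subnKC// rdistC; have := r0 m; lra.
have : cvg (x @ \oo).
  apply: cauchy_cvg; apply/cauchy_rnormP => e e0.
  have [n _ /(_ n (leqnn n)) rn] : \forall n \near \oo, `|r n| < e.
    by have /cvgr0Pnorm_lt := rcvg; exact.
  exists (x n); apply: filterS (xnear n) => m /le_trans; apply.
  by rewrite ltW// (le_lt_trans (ler_norm _)).
move=> /cvg_ex[l xl]; exists l; split => // n.
apply/ler_addgt0Pr => e e0; near \oo => m.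
rewrite (le_trans (ler_rdistD (x m) _ _))// addrC lerD//.
  by rewrite rdistC; near: m; exact: xnear.
by near: m; have /cvg_rnormP := xl; exact.
Unshelve. all: by end_near. Qed.

Lemma cvg_geometric_half {R : realType} (a : R) :
  (a * 2^-1 ^+ n) @[n --> \oo] --> (0 : R).
Proof.
by apply: cvg_geometric; rewrite gtr0_norm ?invr_gt0// invf_lt1// ltr1n.
Qed.

(** * Banach's bounded inverse theorem *)

Section bounded_inverse.
Context {R : realType} {V W : completeNormedModType R[i]}.
Variables (A : {linear V -> W}) (M : R) (Ainv : W -> V).
Hypothesis A_bounded : forall x, rnorm (A x) <= M * rnorm x.
Hypotheses (AK : cancel A Ainv) (AinvK : cancel Ainv A).

(* Baire's argument: some A(B_k) is dense in a ball, since otherwise nested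
   balls avoiding A(B_0), A(B_1), ... would shrink to a point outside im A. *)
Lemma image_ball_somewhere_dense : exists (k : nat) y0 (r : R), 0 < r /\
  forall y, rnorm (y - y0) <= r -> forall e : R, 0 < e ->
    exists x, rnorm x <= k%:R /\ rnorm (y - A x) < e.
Proof.
apply: contrapT => ndense.
(* The premise [0 < ks.2.2] sits under the existential so that [choice] yields a total step
   function. *)
have step (ks : nat * (W * R)) : exists s : W * R, 0 < ks.2.2 ->
    [/\ 0 < s.2, rnorm (s.1 - ks.2.1) + s.2 <= ks.2.2, s.2 <= ks.2.2 / 2 &
        forall x, rnorm x <= ks.1%:R -> s.2 < rnorm (s.1 - A x)].
  case: ks => k [y0 r] /=; have [r0|r0] := ltP 0 r; last by exists (y0, r).
  apply: contrapT => nstep; apply: ndense; exists k, y0, (r / 2).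
  split; first by rewrite divr_gt0.
  move=> y yy0 e e0; apply: contrapT => nx; apply: nstep.
  have m1 : Num.min (e / 2) (r / 2) <= e / 2 by rewrite ge_min lexx.
  have m2 : Num.min (e / 2) (r / 2) <= r / 2 by rewrite ge_min lexx orbT.
  (* A radius at most [r / 2] keeps the new ball in the old one; a radius at most [e / 2] makes it
     miss the images of all [x] of norm at most [k]. *)
  exists (y, Num.min (e / 2) (r / 2)) => /= _; split => //.
  - by rewrite lt_min !divr_gt0.
  - by lra.
  - move=> x xk; rewrite ltNge; apply/negP => yx; apply: nx; exists x.
    by split => //; lra.
have [f fP] := choice step.
pose s := fix s n := if n is n'.+1 then f (n', s n') else (0 : W, 1 : R).
have s0 n : 0 < (s n).2 by elim: n => [|n ih] //=; case: (fP (n, s n) ih).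
have sP n := fP (n, s n) (s0 n).
have sle n : (s n).2 <= 1 * 2^-1 ^+ n.
  elim: n => [|n ih]; first by rewrite expr0 mulr1.
  have [_ _ /= le2 _] := sP n; rewrite (le_trans le2)// exprSr mulrA.
  by rewrite ler_pM2r// invr_gt0.
have [|n|| l [_ lP]] := @nested_balls _ _ (fun n => (s n).1) (fun n => (s n).2).
- by move=> n; have [] := sP n.
- exact: ltW.
- apply: squeeze_cvgr (cvg_cst _) (cvg_geometric_half 1).
  by apply: nearW => n; rewrite ltW//= sle.
(* The preimage of [l] has norm below [n], so ball [n.+1] misses its image, which is [l] itself; yet
   [l] lies in every ball. *)
pose n := (Num.truncn (rnorm (Ainv l))).+1.
have [_ _ _ /(_ (Ainv l) (ltW (truncnS_gt _)))] := sP n.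
by rewrite AinvK rdistC ltNge => /negP; apply; exact: lP n.+1.
Qed.

(** With [t = r / |y|], both [y0] and [y0 + t y] lie in the ball where density holds. Subtracting
    their approximate preimages cancels [y0]; dividing by [t] turns the norm bound [2 k] into
    [2 k |y| / r] and the total tolerance [r / 4 + r / 4] into [|y| / 2]. *)
Lemma approximate_preimage : exists C : R, 0 <= C /\ forall y, exists x,
  rnorm x <= C * rnorm y /\ rnorm (y - A x) <= rnorm y / 2.
Proof.
have [k [y0 [r [r0 dense]]]] := image_ball_somewhere_dense.
exists (2 * k%:R / r); split; first by rewrite divr_ge0 ?mulr_ge0 ?(ltW r0).
move=> y; have [y0'|yn0] := eqVneq (rnorm y) 0.
  by exists 0; rewrite linear0 subr0 rnorm0 y0' mulr0 mul0r.
have y_gt0 : 0 < rnorm y by rewrite lt_neqAle eq_sym yn0 rnorm_ge0.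
pose t := r / rnorm y.
have t0 : 0 < t by rewrite divr_gt0.
have r4 : 0 < r / 4 by rewrite divr_gt0.
have [|x1 [x1k x1A]] := dense (y0 + t%:C *: y) _ _ r4.
  by rewrite addrAC subrr add0r rnormZr ?(ltW t0)// /t divfK.
have [|x2 [x2k x2A]] := dense y0 _ _ r4.
  by rewrite subrr rnorm0 (ltW r0).
have tE : t^-1 = rnorm y / r by rewrite invf_div.
exists ((t^-1)%:C *: (x1 - x2)); split.
  rewrite rnormZr ?invr_ge0 ?(ltW t0)// tE.
  have -> : 2 * k%:R / r * rnorm y = rnorm y / r * (k%:R + k%:R) by ring.
  rewrite ler_wpM2l ?divr_ge0 ?rnorm_ge0 ?(ltW r0)//.
  by rewrite (le_trans (rnormD _ _))// rnormN lerD.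
have -> : y - A ((t^-1)%:C *: (x1 - x2)) =
    (t^-1)%:C *: ((y0 + t%:C *: y - A x1) - (y0 - A x2)).
  have -> : y0 + t%:C *: y - A x1 - (y0 - A x2) = t%:C *: y - A (x1 - x2).
    rewrite (linearB A) -[y0 + _ + _]addrA [y0 + (_ + - A x1)]addrC addrKA.
    by rewrite opprK opprB addrA [RHS]addrAC.
  rewrite linearZ /= [RHS]scalerBr scalerA -rmorphM /= mulVf ?(gt_eqF t0)//.
  by rewrite scale1r.
rewrite rnormZr ?invr_ge0 ?(ltW t0)// tE.
have -> : rnorm y / 2 = rnorm y / r * (r / 4 + r / 4).
  by field; exact: lt0r_neq0.
rewrite ler_wpM2l ?divr_ge0 ?rnorm_ge0 ?(ltW r0)//.
by rewrite (le_trans (rnormD _ _))// rnormN lerD// ltW.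
Qed.

(** Approximate preimages of the successive residuals [res n] are summed into [app n]. The residuals
    at least halve at each step, so the sums converge to an exact preimage, which injectivity
    identifies with [x]. *)
Lemma bounded_inverse : exists C : R, 0 < C /\
  forall x, rnorm x <= C * rnorm (A x).
Proof.
have [C [C0 /choice[g gP]]] := approximate_preimage.
(* The geometric series contributes the factor 2; the added 1 keeps the constant positive if
   [C = 0]. *)
exists (C * 2 + 1); split; first by rewrite ltr_wpDl ?mulr_ge0.
move=> x; set y := A x.
pose res := fix res n := if n is n'.+1 then res n' - A (g (res n')) else y.
pose app := fix app n := if n is n'.+1 then app n' + g (res n') else 0.
have resE n : A (app n) = y - res n.
  elim: n => [|n ih] /=; first by rewrite linear0 subrr.
  by rewrite linearD ih opprB addrA addrAC.
have resle n : rnorm (res n) <= rnorm y * 2^-1 ^+ n.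
  elim: n => [|n ih] /=; first by rewrite expr0 mulr1.
  rewrite (le_trans (gP _).2)// exprSr mulrA ler_pM2r// invr_gt0//.
(* The tail from [n] on of the geometric series that bounds the corrections, with terms
   [C * rnorm y / 2 ^ j]. *)
pose r n := C * 2 * rnorm y * 2^-1 ^+ n.
have r0 n : 0 <= r n by rewrite !mulr_ge0// ?rnorm_ge0// exprn_ge0// invr_ge0.
have [n|||l [_ lP]] := @nested_balls _ _ app r.
- rewrite /= addrAC subrr add0r -lerBrDr.
  have -> : r n - r n.+1 = C * (rnorm y * 2^-1 ^+ n).
    by rewrite /r exprS; lra.
  by rewrite (le_trans (gP _).1)// ler_wpM2l.
- exact: r0.
- exact: cvg_geometric_half.
(* Continuity of [A] sends [A (l - app n)] to 0, and [res n] tends to 0 as well. [M] carries no sign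
   condition, hence the absolute value. *)
have Al : A l = y.
  apply/eqP; rewrite -subr_eq0; apply/eqP/rnorm_eq0/eqP.
  rewrite eq_le rnorm_ge0 andbT.
  have cvg0 : (`|M| * (C * 2 * rnorm y) * 2^-1 ^+ n + rnorm y * 2^-1 ^+ n)
      @[n --> \oo] --> (0 : R).
    by rewrite -[X in _ --> X]addr0; apply: cvgD; exact: cvg_geometric_half.
  apply: (cvgr_to_ge cvg0).
  apply: nearW => n.
  have -> : A l - y = A (l - app n) - res n.
    by rewrite (linearB A) resE opprB addrA [RHS]addrAC addrK.
  rewrite (le_trans (rnormD _ _))// rnormN lerD//.
  rewrite (le_trans (A_bounded _))// -mulrA.
  rewrite (le_trans (ler_wpM2r (rnorm_ge0 _) (ler_norm M)))// ler_wpM2l//.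
have -> : x = l by rewrite -[x]AK -/y -Al AK.
have := lP 0%N; rewrite subr0 /r expr0 mulr1 => /le_trans; apply.
by rewrite mulrDl mul1r lerDl rnorm_ge0.
Qed.

End bounded_inverse.

(** * Lower semicontinuity of the p-norm *)

Section lpnorm_limits.
Context {R : realType} {N : nat} {X : normedModType R[i]}.
Local Notation Z := 'rV[int]_N.
Implicit Types (u v : Z -> X) (p : \bar R).

Lemma lpnorm_fin_leP (r M : R) u : 1 <= r -> 0 <= M ->
  (lpnorm r%:E u <= M%:E)%E <->
  (\esum_(k in setT) (rnorm (u k) `^ r)%:E <= (M `^ r)%:E)%E.
Proof.
move=> r1 M0; have r_ge0 : 0 <= r by rewrite (le_trans _ r1).
have r0 : r != 0 by rewrite gt_eqF// (lt_le_trans _ r1).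
have S0 := lpsum_ge0 r u.
split=> [uM|uM].
  rewrite -(poweRe1 S0) -(mulVf r0) poweRrM -poweR_EFin.
  by rewrite poweR_le// poweR_ge0.
rewrite -[M%:E]poweRe1 ?lee_fin// -(mulfV r0) poweRrM poweR_EFin.
by rewrite poweR_le ?invr_ge0.
Qed.

(** An unordered sum is the supremum of its finite partial sums, and the sup norm is determined by
    singletons. This leaves finitely many coordinates, over which filter sets can be intersected. *)
Lemma lpnorm_ub_cutoff p u (M : R) : (1 <= p)%E -> 0 <= M ->
  (forall D : set Z, finite_set D -> (lpnorm p (cutoff D u) <= M%:E)%E) ->
  (lpnorm p u <= M%:E)%E.
Proof.
case: p => [r| |] //; rewrite ?lee_fin => r1 M0 uM.
  apply/lpnorm_fin_leP => //; apply: ge_ereal_sup => _ [D [finD _] <-].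
  have /lpnorm_fin_leP := uM D finD; move=> /(_ r1 M0); apply: le_trans.
  apply: esum_ge; exists D => //; rewrite le_eqVlt; apply/orP; left.
  by apply/eqP/eq_fsbigr => k kD; rewrite /cutoff kD.
apply: lpnormy_le => k; apply: le_trans (uM [set k] (finite_set1 k)).
rewrite (le_trans _ (rnorm_le_lpnormy _ k))// /cutoff.
by rewrite in_set1 eqxx.
Qed.

Lemma lpnorm_rnorm_le p u k : (1 <= p)%E -> ((rnorm (u k))%:E <= lpnorm p u)%E.
Proof.
case: p => [r| |] //; rewrite ?lee_fin => r1; last exact: rnorm_le_lpnormy.
have r0 : r != 0 by rewrite gt_eqF// (lt_le_trans _ r1).
rewrite -[_%:E]poweRe1 ?lee_fin ?rnorm_ge0// -(mulfV r0) poweRrM poweR_EFin.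
rewrite poweR_le ?invr_ge0 ?(le_trans _ r1)// ?lee_fin ?powR_ge0//.
exact: rnorm_powR_le_lpsum.
Qed.

(* Fatou's lemma for the counting measure; where [l k] is nonzero,
   [c * rnorm (l k) < rnorm (l k)] is eventually below [rnorm (w t k)]. *)
Lemma lpnorm_lsc p (T : Type) (F : set_system T) (FF : ProperFilter F)
    (w : T -> Z -> X) (l : Z -> X) (M : R) : (1 <= p)%E -> 0 <= M ->
  (forall k, w t k @[t --> F] --> l k) ->
  (\forall t \near F, (lpnorm p (w t) <= M%:E)%E) ->
  (lpnorm p l <= M%:E)%E.
Proof.
move=> p1 M0 wl wM; apply: lpnorm_ub_cutoff => // D finD.
have H (c : R) : 0 < c < 1 -> (c%:E * lpnorm p (cutoff D l) <= M%:E)%E.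
  move=> /andP[c0 c1].
  have nearD : \forall t \near F,
      forall k, D k -> c * rnorm (l k) <= rnorm (w t k).
    rewrite -(fset_setK finD).
    apply: (@filter_bigI _ _ _ (fun k t => c * rnorm (l k) <= rnorm (w t k))).
    move=> k _.
    have [->|lk0] := eqVneq (rnorm (l k)) 0.
      by apply: nearW => t; rewrite mulr0 rnorm_ge0.
    have lk_gt0 : 0 < rnorm (l k) by rewrite lt_neqAle eq_sym lk0 rnorm_ge0.
    have /cvg_rnormP/(_ ((1 - c) * rnorm (l k))) := wl k.
    rewrite mulr_gt0 ?subr_gt0// => /(_ isT); apply: filterS => t.
    have := rnormD (l k - w t k) (w t k); rewrite subrK; lra.
  have [t [wtM wtD]] := filter_ex (filterI wM nearD).
  apply: le_trans wtM.
  have -> : c%:E = (complex.Re `|c%:C|)%:E by rewrite ger0_norm ?ler0c ?ltW.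
  rewrite -lpnormZ//; apply: le_lpnorm => // k.
  rewrite /cutoff !fctE; case: ifPn => [/set_mem kD|_].
    by rewrite rnormZr ?(ltW c0)// wtD.
  by rewrite scaler0 rnorm0 rnorm_ge0.
(* The case [c = 1 / 2] rules out [+oo] before real arithmetic starts. *)
have fin : lpnorm p (cutoff D l) \is a fin_num.
  rewrite ge0_fin_numE ?lpnorm_ge0//.
  have := H (2^-1); rewrite invr_gt0 ltr0n invf_lt1// ltr1n => /(_ isT).
  case: (lpnorm p (cutoff D l)) => [x| |]//; first by rewrite ltry.
  by rewrite gt0_muley// lte_fin invr_gt0.
move: H; rewrite -(fineK fin); set x := fine _ => H.
rewrite lee_fin leNgt; apply/negP => Mx.
have x0 : 0 < x by rewrite (le_lt_trans M0).
(* This [c] would give [(M + x) / 2 <= M], against [M < x]. *)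
have c01 : 0 < (M + x) / 2 / x < 1.
  by rewrite !divr_gt0 ?ltr_wpDl//= ltr_pdivrMr// mul1r; lra.
by have := H _ c01; rewrite -EFinM lee_fin divfK ?(gt_eqF x0)//; lra.
Qed.

End lpnorm_limits.

(** An eventual bound by a real already forces finiteness, so limits in [\bar R] reduce to plain
    estimates. *)
Lemma cvge0_le {R : realType} (T : Type) (F : set_system T) (FF : Filter F)
    (f : T -> \bar R) : (forall t, 0 <= f t)%E ->
  f @ F --> 0%E <-> forall e : R, 0 < e -> \forall t \near F, (f t <= e%:E)%E.
Proof.
move=> f0; split=> [/fine_cvgP[fin /cvgr0Pnorm_le fcvg] e e0|fle].
  near=> t; have ft : f t \is a fin_num by near: t.
  rewrite -(fineK ft) lee_fin (le_trans (ler_norm _))//.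
  by near: t; exact: fcvg.
have fin e t : (f t <= e%:E)%E -> f t \is a fin_num.
  by move=> fe; rewrite ge0_fin_numE// (le_lt_trans fe)// ltry.
apply/fine_cvgP; split.
  by apply: filterS (fle 1 ltr01) => t; exact: fin.
apply/cvgr0Pnorm_le => e e0; apply: filterS (fle e e0) => t fte.
by rewrite ger0_norm ?fine_ge0// -lee_fin fineK// (fin e).
Unshelve. all: by end_near. Qed.

Section lpnorm_opp.
Context {R : realType} {N : nat} {X : normedModType R[i]}.
Implicit Types u : 'rV[int]_N -> X.

Lemma lpnormN p u : (1 <= p)%E -> lpnorm p (- u)%R = lpnorm p u.
Proof. by move=> p1; rewrite -scaleN1r lpnormZ// normrN normr1 mul1e. Qed.

Lemma le_lpnorm_cutoffB p D u : (1 <= p)%E ->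
  (lpnorm p (u - cutoff D u)%R <= lpnorm p u)%E.
Proof.
move=> p1; apply: le_lpnorm => // k; rewrite !fctE /cutoff.
by case: ifP => _; rewrite ?subrr ?subr0// rnorm0 rnorm_ge0.
Qed.

End lpnorm_opp.

(** * Completeness of the sequence spaces *)

Section seqspace_norm.
Context {R : realType} {N : nat} {X : normedModType R[i]}.
Context {Omega : set 'rV[R]_N} {p : \bar R} {p1 : (1 <= p)%E}.
Local Notation E := (seqspace X Omega p1).
Implicit Types u v : E.

Lemma rnorm_lpnorm u : (rnorm u)%:E = lpnorm p u.
Proof. by rewrite -[RHS]fineK ?lpnorm_fin. Qed.

Lemma seqspaceB u v : seqval (u - v) = seqval u - seqval v.
Proof. by []. Qed.

Lemma rnorm_coord u k : rnorm (u k) <= rnorm u.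
Proof. by rewrite -lee_fin rnorm_lpnorm; exact: lpnorm_rnorm_le. Qed.

End seqspace_norm.

Section seqspace_complete.
Context {R : realType} {N : nat} {X : completeNormedModType R[i]}.
Context {Omega : set 'rV[R]_N} {p : \bar R} {p1 : (1 <= p)%E}.
Local Notation E := (seqspace X Omega p1).

(** For finite [p] only finiteness of the norm must pass to the limit. For [p = +oo] the decay
    required by [c0] must pass too, and it does because subtracting a cutoff does not increase the
    norm of [l - v]. *)
Lemma seqset_closed (l : 'rV[int]_N -> X) :
  (forall e : R, 0 < e ->
    exists v : E, (lpnorm p (l - seqval v)%R <= e%:E)%E) ->
  seqset X Omega p l.
Proof.
move=> lv; have llp : lp p l.
  have [v lv1] := lv 1 ltr01.
  rewrite /lp /= -(subrK (v : _ -> X) l) (le_lt_trans (ler_lpnormD _ _ p1))//.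
  rewrite lte_add_pinfty// ?(le_lt_trans lv1) ?ltry//.
  by rewrite -rnorm_lpnorm ltry.
rewrite /seqset; case: eqP => // py; split; first by rewrite -py.
apply/cvge0_le => [n|e e0]; first by rewrite lpnorm_ge0// leey.
have [v lve] := lv (e / 2) (divr_gt0 e0 (ltr0Sn _ 1)).
have [_ vc] : c0 X Omega v by have := seqvalP v; rewrite /seqset; case: eqP.
have /cvge0_le/(_ (e / 2)) := vc; rewrite divr_gt0// => vcut.
have {}vcut := vcut (fun n => lpnorm_ge0 _ (leey _)) isT.
apply: filterS vcut => n vn.
set D := lattice_section Omega n in vn *.
have -> : cutoff D l - l =
    (cutoff D v - v) - ((l - v) - cutoff D (l - v)).
  apply/funext => k; rewrite /cutoff !fctE; case: ifP => _.
    by rewrite !subrr.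
  by rewrite subr0 !sub0r opprB addKr.
rewrite (le_trans (ler_lpnormD _ _ (leey _)))//.
rewrite [e]splitr EFinD leeD//.
by rewrite lpnormN ?leey// (le_trans (le_lpnorm_cutoffB _ _ (leey _)))// -{1}py.
Qed.

(** Coordinates are Cauchy in [X], which gives a pointwise limit [l]. Lower semicontinuity, applied
    to [y - v] with [v] fixed and [y] running along [F], transfers the Cauchy bound to [l - v]. *)
Lemma seqspace_complete (F : set_system E) :
  ProperFilter F -> cauchy F -> cvg F.
Proof.
move=> FF /cauchy_rnormP cF.
pose l k := lim ((fun u : E => u k) @ F).
have Fl k : (fun u : E => u k) @ F --> l k.
  apply: cauchy_cvg; apply/cauchy_rnormP => e /cF[x Fx].
  exists (x k); apply: filterS Fx => y; apply: le_trans.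
  exact: (rnorm_coord (x - y)).
have near_l (e : R) : 0 < e ->
  \forall v \near F, (lpnorm p (l - seqval v)%R <= e%:E)%E.
  move=> e0; have [x Fx] := cF (e / 2) (divr_gt0 e0 (ltr0Sn _ 1)).
  apply: filterS (Fx) => v xv.
  apply: (@lpnorm_lsc _ _ _ _ _ F _ (fun y : E => seqval y - seqval v)) => //.
  - exact: ltW.
  - by move=> k; apply: cvgB; [exact: Fl|exact: cvg_cst].
  - apply: filterS Fx => y xy; rewrite -seqspaceB -rnorm_lpnorm lee_fin.
    by rewrite (le_trans (ler_rdistD x _ _))// rdistC [e]splitr lerD.
have lE : l \in seqpred X Omega p1.
  apply/seqpredP/seqset_closed => e e0.
  by have [v vl] := filter_ex (near_l e e0); exists v.
apply/cvg_ex; exists (Seqspace lE : E).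
apply/(@cvg_rnormP _ E _ F _ id) => e /near_l; apply: filterS => v.
by rewrite -lee_fin rnorm_lpnorm.
Qed.

HB.instance Definition _ := Uniform_isComplete.Build E seqspace_complete.

End seqspace_complete.

(** * Strong convergence of the truncations to the identity *)

Lemma near_lattice_section {R : realType} {N : nat} (Omega : set 'rV[R]_N)
    (k : 'rV[int]_N) : valid_starlike Omega ->
  \forall m \near \oo, lattice_section Omega m k.
Proof.
move=> [_ [x Ox] Oint].
(* Starlikeness at [alpha = 0] puts the origin in the interior, so [k / m] enters [Omega] for large
   [m]. *)
have : nbhs (0 : 'rV[R]_N) Omega.
  by rewrite -(scale0r x); apply: (Oint x 0 Ox); rewrite lexx ltr01.
have cvg0 : (m%:R^-1 : R) *: map_mx intr k @[m --> \oo] --> (0 : 'rV[R]_N).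
  rewrite -(scale0r (map_mx intr k)); apply: cvgZr_tmp.
  apply/gtr0_cvgV0; last exact: cvgr_idn.
  by near=> m; rewrite ltr0n; near: m; exact: nbhs_infty_gt.
move=> /cvg0 => Om; near=> m.
exists ((m%:R^-1 : R) *: map_mx intr k); first by near: m.
rewrite scalerA mulfV ?scale1r// pnatr_eq0 -lt0n.
by near: m; exact: nbhs_infty_gt.
Unshelve. all: by end_near. Qed.

(** Some finite partial sum comes within [e ^ r] of the whole sum, so the coordinates off [D]
    contribute less than that. Uniformity in [D'] lets every late lattice section be substituted. *)
Lemma lpnorm_cutoff_tail {R : realType} {N : nat} {X : normedModType R[i]}
    (r e : R) (u : 'rV[int]_N -> X) : 1 <= r -> lp r%:E u -> 0 < e ->
  exists2 D, finite_set D &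
    forall D', D `<=` D' -> (lpnorm r%:E (u - cutoff D' u)%R <= e%:E)%E.
Proof.
move=> r1 ulp e0; have r0 : r != 0 by rewrite gt_eqF// (lt_le_trans _ r1).
pose a k := (rnorm (u k) `^ r)%:E.
have a0 k : (0 <= a k)%E by rewrite lee_fin powR_ge0.
have r1e : (1 <= r%:E)%E by rewrite lee_fin.
have lpfin : lpnorm r%:E u \is a fin_num by rewrite ge0_fin_numE ?lpnorm_ge0.
have fin : (\esum_(k in setT) a k)%E \is a fin_num.
  by rewrite (lpsumE r1 (fine_ge0 (lpnorm_ge0 u r1e)) (esym (fineK lpfin))).
have [_ [D [finD _] <-] Dlt] := ub_ereal_sup_adherent (powR_gt0 r e0) fin.
exists D => // D' DD'; apply/lpnorm_fin_leP => //; first exact: ltW.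
have sumE : (\esum_(k in setT) a k =
  \sum_(k \in D) a k + \esum_(k in ~` D) a k)%E.
  by rewrite (esumID D)// !setTI esum_fset.
apply: (@le_trans _ _ (\esum_(k in ~` D) a k)%E).
  rewrite [leRHS]esum_mkcond; apply: le_esum => k _.
  rewrite !fctE /cutoff; case: ifPn => [_|kD'].
    by rewrite subrr rnorm0 powR0//; case: ifP.
  rewrite subr0 ifT// inE => /DD' kD; move: kD'; rewrite notin_setE; exact.
move: fin Dlt; rewrite -/(esum setT a) sumE fin_numD => /andP[fin1 fin2].
by rewrite lteBlDr// lteD2lE// => /ltW.
Qed.

(** For [p = +oo] this is the decay built into [c0], up to sign. For finite [p], a finite set
    carrying all but a small tail is eventually inside the lattice sections. *)
Lemma truncQ_cvg0 {R : realType} {N : nat} {X : normedModType R[i]}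
    {Omega : set 'rV[R]_N} {p : \bar R} {p1 : (1 <= p)%E}
    (u : seqspace X Omega p1) : valid_starlike Omega ->
  forall e : R, 0 < e -> \forall m \near \oo, rnorm (truncQ m u) <= e.
Proof.
move=> sO e e0; case: p p1 u => [r r1| |] //; last first.
  move=> py u.
  have [_ /cvge0_le uc] := seqvalP u.
  apply: filterS (uc (fun n => lpnorm_ge0 _ py) e e0) => m.
  rewrite -lee_fin rnorm_lpnorm; apply: le_trans.
  by rewrite -lpnormN// opprB.
move=> u; have [D finD DP] := lpnorm_cutoff_tail r1 (seqvalP u) e0.
have : \forall m \near \oo, forall k, D k -> lattice_section Omega m k.
  rewrite -(fset_setK finD).
  apply: (@filter_bigI _ _ _ (fun k m => lattice_section Omega m k)) => k _.
  exact: near_lattice_section.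
by apply: filterS => m Dm; rewrite -lee_fin rnorm_lpnorm DP.
Qed.

(** * Linearity of the truncations; operator norm bounds *)

Section truncation_linear.
Context {R : realType} {N : nat} {X : normedModType R[i]}.
Context {Omega : set 'rV[R]_N} {p : \bar R} {p1 : (1 <= p)%E}.
Local Notation E := (seqspace X Omega p1).

Lemma truncP_linear n : linear (@truncP R N X Omega p p1 n).
Proof. by move=> c u v; apply/val_inj; exact: cutoff_linear. Qed.

HB.instance Definition _ n :=
  GRing.isLinear.Build R[i] E E _ (@truncP R N X Omega p p1 n)
    (truncP_linear n).

Lemma truncQ_linear n : linear (@truncQ R N X Omega p p1 n).
Proof.
by move=> c u v; rewrite /truncQ linearP scalerBr opprD addrACA.
Qed.

HB.instance Definition _ n :=
  GRing.isLinear.Build R[i] E E _ (@truncQ R N X Omega p p1 n)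
    (truncQ_linear n).

Lemma truncPK n (u : E) : truncP n (truncP n u) = truncP n u.
Proof.
apply/val_inj/funext => k; rewrite /= /cutoff.
by case kD: (k \in _); rewrite //= /cutoff kD.
Qed.

Lemma rnorm_truncP n (u : E) : rnorm (truncP n u) <= rnorm u.
Proof. by rewrite -lee_fin !rnorm_lpnorm; exact: le_lpnorm_cutoff. Qed.

Lemma truncPQ n (u : E) : truncP n u + truncQ n u = u.
Proof. by rewrite /truncQ addrC subrK. Qed.

End truncation_linear.

(** Nonzero vectors are scaled to norm one. Homogeneity as a bare hypothesis covers plain
    compositions such as [truncQ m \o A \o truncP n]. *)
Lemma rnorm_le_opnorm {R : realType} {V W : normedModType R[i]} (T : V -> W)
    (c : R) : (forall (t : R[i]) v, T (t *: v) = t *: T v) ->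
  (opnorm T <= c%:E)%E -> forall v, rnorm (T v) <= c * rnorm v.
Proof.
move=> TZ Tc v; have [v0|vn0] := eqVneq (rnorm v) 0.
  by rewrite (rnorm_eq0 v0) -(scale0r (0 : V)) TZ !scale0r !rnorm0 mulr0.
have v0 : 0 < rnorm v by rewrite lt_neqAle eq_sym vn0 rnorm_ge0.
rewrite -ler_pdivrMr// mulrC -rnormZr ?invr_ge0 ?rnorm_ge0// -TZ.
rewrite -lee_fin (le_trans _ Tc)//; apply: ereal_sup_ubound.
exists ((rnorm v)^-1%:C *: v) => //=.
by rewrite rnormZr ?invr_ge0 ?rnorm_ge0// mulVf.
Qed.

Lemma opnorm_ge0 {R : realType} {V W : normedModType R[i]} (T : V -> W) :
  (0 <= opnorm T)%E.
Proof.
rewrite (@le_trans _ _ (rnorm (T 0))%:E) ?lee_fin ?rnorm_ge0//.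
by apply: ereal_sup_ubound; exists 0 => //=; rewrite rnorm0.
Qed.

(** * Error estimate for solutions of the truncated inequality *)

Section stability.
Context {R : realType} {N : nat} {X : normedModType R[i]}.
Context {Omega : set 'rV[R]_N} {p : \bar R} {p1 : (1 <= p)%E}.
Local Notation E := (seqspace X Omega p1).
Variables (A : {linear E -> E}) (Ainv : E -> E) (C : R).
Hypotheses (AinvK : cancel Ainv A) (C_gt0 : 0 < C).
Hypothesis A_below : forall u, rnorm u <= C * rnorm (A u).

(** The first bound on [eta] serves the absorption, the second makes [C * eta * |u|] at most
    [eps / 3]: its [6 * C ^+ 2] collects [C] from [A_below], [2 * C] from the a priori bound on [u],
    and 3 from the splitting of [eps]. The added 1 keeps the denominator positive. *)
Lemma rFSM_error (b u : E) (eps delta eta : R) (m n : nat) :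
  0 <= delta -> delta < eps / (3 * C) -> eta <= (2 * C)^-1 ->
  eta <= eps / (6 * C ^+ 2 * (delta + rnorm b + 1)) ->
  0 <= eta ->
  (forall v, rnorm (truncQ m (A (truncP n v))) <= eta * rnorm v) ->
  rnorm (truncQ m b) <= eps / (3 * C) ->
  rFSM A b delta m n u -> rnorm (u - Ainv b) < eps.
Proof.
move=> delta0 delta_lt eta_le1 eta_le2 eta0 QAP Qb [[w _ uE]].
have {w uE}Pu : truncP n u = u by rewrite -uE truncPK.
rewrite Pu rnormE ltcR => res; have := QAP u; rewrite Pu => {QAP}QA.
have C0 := ltW C_gt0.
have C3 : 0 < 3 * C by rewrite mulr_gt0.
have b0 := rnorm_ge0 b; have u_ge0 := rnorm_ge0 u.
have K0 : 0 < delta + rnorm b + 1 by rewrite ltr_wpDl// addr_ge0.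
have Au : rnorm (A u) <= delta + rnorm b + eta * rnorm u.
  rewrite -[A u](truncPQ m) (le_trans (rnormD _ _))// lerD//.
  have := rnormD (truncP m (A u) - truncP m b) (truncP m b).
  by rewrite subrK; have := rnorm_truncP m b; lra.
have u_le : rnorm u <= 2 * C * (delta + rnorm b).
  have := A_below u; have := ler_wpM2l C0 Au.
  have : C * (eta * rnorm u) <= rnorm u / 2.
    rewrite mulrA mulrC ler_wpM2l//.
    rewrite (le_trans (ler_wpM2l C0 eta_le1))//.
    by rewrite invfM mulrCA mulfV ?gt_eqF// mulr1.
  lra.
have CQA : C * rnorm (truncQ m (A u)) <= eps / 3.
  have le1 := ler_wpM2l C0 QA; have le2 := ler_wpM2l eta0 u_le.
  have le3 := ler_wpM2l C0 le2.
  have K_le : delta + rnorm b <= delta + rnorm b + 1 by rewrite lerDl.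
  have le4 : 2 * C ^+ 2 * (delta + rnorm b) * eta <=
      2 * C ^+ 2 * (delta + rnorm b + 1) *
      (eps / (6 * C ^+ 2 * (delta + rnorm b + 1))).
    rewrite ler_pM// ?mulr_ge0 ?addr_ge0 ?exprn_ge0//.
    by rewrite ler_wpM2l ?mulr_ge0 ?exprn_ge0.
  have e4 : 2 * C ^+ 2 * (delta + rnorm b + 1) *
      (eps / (6 * C ^+ 2 * (delta + rnorm b + 1))) = eps / 3.
    by field; rewrite !lt0r_neq0.
  rewrite e4 in le4; apply: le_trans le1 (le_trans le3 _).
  by apply: le_trans le4; rewrite le_eqVlt; apply/orP; left; apply/eqP; ring.
have CQb : C * rnorm (truncQ m b) <= eps / 3.
  rewrite (le_trans (ler_wpM2l C0 Qb))// le_eqVlt; apply/orP; left; apply/eqP.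
  by field; exact: lt0r_neq0.
(* The only strict third, which makes the final bound strict. *)
have Cd : C * delta < eps / 3.
  have -> : eps / 3 = C * (eps / (3 * C)) by field; exact: lt0r_neq0.
  by rewrite ltr_pM2l.
have AuB : rnorm (A u - b) <=
    delta + rnorm (truncQ m (A u)) + rnorm (truncQ m b).
  rewrite -{1}[A u](truncPQ m) -{1}[b](truncPQ m) opprD addrACA.
  rewrite -[leRHS]addrA (le_trans (rnormD _ _))// lerD ?(ltW res)//.
  by rewrite (le_trans (rnormD _ _))// rnormN.
have := A_below (u - Ainv b); rewrite linearB AinvK => /le_lt_trans; apply.
by apply: le_lt_trans (ler_wpM2l C0 AuB) _; lra.
Qed.

End stability.

(** * Choice of the parameters *)

Theorem theorem3p4 (R : realType) (N : nat) (N_gt0 : (0 < N)%N)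
  (X : completeNormedModType R[i])
  (Omega : set 'rV[R]_N) (starlike_Omega : valid_starlike Omega)
  (p : \bar R) (p1 : (1 <= p)%E)
  (A : {linear seqspace X Omega p1 -> seqspace X Omega p1})
  (A_bounded : (opnorm A < +oo)%E)
  (Ainv : seqspace X Omega p1 -> seqspace X Omega p1)
  (AK : cancel A Ainv) (AinvK : cancel Ainv A)
  (QAP_cvg0 : forall n : nat, (0 < n)%N ->
    opnorm (truncQ m \o A \o truncP n) @[m --> \oo] --> 0%E)
  (b : seqspace X Omega p1) :
  let u0 := Ainv b in
  (forall eps : R, 0 < eps ->
    exists (delta : R) (m n : nat), [/\ 0 < delta, (0 < m)%N, (0 < n)%N &
      forall u, rFSM A b delta m n u -> `|u - u0| < eps%:C])
  /\
  exists (delta0 : {posnum R} -> {posnum R}) (n0 : {posnum R} -> nat)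
         (m0 : {posnum R} -> {posnum R} -> nat -> nat),
    [/\ forall delta, (0 < n0 delta)%N,
        forall eps delta n, (0 < n)%N -> (0 < m0 eps delta n)%N &
        forall (eps delta : {posnum R}) (m n : nat), (0 < m)%N -> (0 < n)%N ->
          delta%:num < (delta0 eps)%:num -> (n0 delta <= n)%N ->
          (m0 eps delta n <= m)%N ->
          forall u, rFSM A b delta%:num m n u -> `|u - u0| < (eps%:num)%:C].
Proof.
move=> u0.
have AZ (t : R[i]) v : A (t *: v) = t *: A v by rewrite linearZ.
have [c Ac] : exists c : R, forall u, rnorm (A u) <= c * rnorm u.
  move: A_bounded; case AE : (opnorm A) => [c| |] // _.
    by exists c; apply: (rnorm_le_opnorm AZ); rewrite AE.
  by exists 0; apply: (rnorm_le_opnorm AZ); rewrite AE leNye.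
have [C [C_gt0 Abelow]] := bounded_inverse Ac AK AinvK.
have eps3 (eps : {posnum R}) : 0 < eps%:num / (3 * C).
  by rewrite divr_gt0 ?mulr_gt0.
suff : exists (delta0 : {posnum R} -> {posnum R}) (n0 : {posnum R} -> nat)
         (m0 : {posnum R} -> {posnum R} -> nat -> nat),
    [/\ forall delta, (0 < n0 delta)%N,
        forall eps delta n, (0 < n)%N -> (0 < m0 eps delta n)%N &
        forall (eps delta : {posnum R}) (m n : nat), (0 < m)%N -> (0 < n)%N ->
          delta%:num < (delta0 eps)%:num -> (n0 delta <= n)%N ->
          (m0 eps delta n <= m)%N ->
          forall u, rFSM A b delta%:num m n u -> `|u - u0| < (eps%:num)%:C].
  move=> H; split => // eps eps0.
  have [delta0 [n0 [m0 [n0_gt0 m0_gt0 close]]]] := H.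
  pose e := PosNum eps0.
  (* Half of [delta0] meets the strict inequality; [n] and [m] are then taken at their
     thresholds. *)
  have delta_gt0 : 0 < (delta0 e)%:num / 2 by [].
  pose delta := PosNum delta_gt0.
  exists delta%:num, (m0 e delta (n0 delta)), (n0 delta).
  split => //; first exact: m0_gt0.
  apply: (close e delta) => //; first exact: m0_gt0.
  by rewrite /= ltr_pdivrMr// ltr_pMr// ltr1n.
(* The conditions on [n] and [delta] stay inside the conclusion, so that [m0] is total and [choice]
   applies. *)
have step (x : {posnum R} * {posnum R} * nat) : exists m0 : nat, (0 < m0)%N /\
    ((0 < x.2)%N -> forall m, (m0 <= m)%N -> forall u,
      rFSM A b x.1.2%:num m x.2 u ->
      x.1.2%:num < x.1.1%:num / (3 * C) -> `|u - u0| < (x.1.1%:num)%:C).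
  case: x => [[eps delta] n] /=.
  have [n0|n_gt0] := posnP n; first by exists 1%N; rewrite n0.
  pose eta := Num.min (2 * C)^-1
    (eps%:num / (6 * C ^+ 2 * (delta%:num + rnorm b + 1))).
  have b1 : 0 < delta%:num + rnorm b + 1.
    by rewrite ltr_wpDl// addr_ge0 ?rnorm_ge0.
  have eta0 : 0 < eta.
    by rewrite lt_min invr_gt0 mulr_gt0 ?divr_gt0 ?mulr_gt0 ?exprn_gt0.
  have /cvge0_le QAP := QAP_cvg0 n n_gt0.
  have {}QAP := QAP (fun m => opnorm_ge0 _) eta eta0.
  have [m0 _ m0P] := filterI QAP (truncQ_cvg0 b starlike_Omega (eps3 eps)).
  (* The successor makes the threshold positive. *)
  exists m0.+1; split => // _ m mm0 u uP delta_lt.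
  have [QAPm Qbm] := m0P m (ltnW mm0).
  rewrite rnormE ltcR.
  apply: (rFSM_error (eta := eta) AinvK C_gt0 Abelow _ delta_lt _ _ _ _ Qbm uP)
    => //.
  - by rewrite /eta ge_min lexx.
  - by rewrite /eta ge_min lexx orbT.
  - exact: ltW.
  - by apply: (rnorm_le_opnorm _ QAPm) => t v; rewrite /= !linearZ.
have [m0 m0P] := choice step.
(* The estimate holds at every positive [n], with [m] chosen afterwards, so the constant 1 serves as
   [n0]. *)
exists (fun eps => PosNum (eps3 eps)), (fun=> 1%N).
exists (fun eps delta n => m0 (eps, delta, n)); split => //.
  by move=> eps delta n _; case: (m0P (eps, delta, n)).
move=> eps delta m n _ n_gt0 delta_lt _ mm0 u uP.
by have [_ /(_ n_gt0 m mm0 u uP delta_lt)] := m0P (eps, delta, n).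
Qed.
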